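(* Let $n\ge 3$, let $D$ be a real symmetric $n\times n$ matrix with $D_{ij}=D_{ji}>0$ for $i\ne j$, and let $d=\lfloor n/2\rfloor$. Then the following two semidefinite programs have equal optimal values. (A) Minimize $\tfrac12\operatorname{trace}\left(DX^{(1)}\right)$ over real symmetric $n\times n$ matrices $X^{(1)},\ldots,X^{(d)}$ subject to $$X^{(k)}\ge 0\ \ (k=1,\ldots,d),\qquad \sum_{k=1}^d X^{(k)}=J-I,\qquad I+\sum_{k=1}^d\cos\left(\frac{2\pi i k}{n}\right)X^{(k)}\succeq 0\ \ (i=1,\ldots,d).$$ (B) Minimize $\tfrac12\operatorname{trace}\left((C_1\otimes D)Y\right)$ over real symmetric $n^2\times n^2$ matrices $Y$ and vectors $y\in\mathbb{R}^{n^2}$ subject to $$\operatorname{trace}\left((I\otimes(J-I))Y+((J-I)\otimes I)Y\right)=0,\qquad \operatorname{trace}(Y)-2e^Ty=-n,$$ $$\begin{pmatrix}1&y^T\\ y&Y\end{pmatrix}\succeq 0,\qquad Y\ge 0.$$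
   Context: $I$ and $J$ denote the $n\times n$ identity and all-ones matrices, and $e$ (in program (B)) is the all-ones vector in $\mathbb{R}^{n^2}$. For a matrix $M$, $M\ge 0$ means entrywise nonnegativity, and $M\succeq 0$ means that $M$ is symmetric positive semidefinite. The Kronecker product $A\otimes B$ is the block matrix whose block $(i,j)$ is $A_{ij}B$. $C_1$ is the $n\times n$ adjacency matrix of the standard circuit on $n$ vertices: $(C_1)_{ij}=1$ if $i-j\equiv\pm1\pmod n$ and $(C_1)_{ij}=0$ otherwise. *)

(* Defs.v *)
From HB Require Import structures.
From mathcomp Require Import all_boot all_order all_algebra.
From mathcomp Require Export mxtens.
From mathcomp Require Import all_classical all_reals all_analysis.

Set Implicit Arguments.
Unset Strict Implicit.
Unset Printing Implicit Defensive.

Import Order.TTheory GRing.Theory Num.Theory.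

Local Open Scope classical_set_scope.
Local Open Scope ring_scope.

(* The Kronecker product is [A *t B] from mxtens: row [i * p + j] of [A *t B],
   for [B] with [p] rows, is indexed by the pair of row indices [(i, j)]. *)

Definition psdmx (R : realType) (m : nat) (A : 'M[R]_m) : Prop :=
  A^T = A /\ forall v : 'cV[R]_m, 0 <= (v^T *m A *m v) 0 0.

Definition nonnegmx (R : realType) (m : nat) (A : 'M[R]_m) : Prop :=
  forall i j, 0 <= A i j.

Definition circuit_mx (R : realType) (n : nat) : 'M[R]_n :=
  \matrix_(i, j)
    ((i%:Z - j%:Z == 1 %[mod n%:Z])%Z || (i%:Z - j%:Z == -1 %[mod n%:Z])%Z)%:R.

Definition allones_mx (R : realType) (n : nat) : 'M[R]_n := const_mx 1.

(* Only the entries [X 1, ..., X n./2] of the family matter. *)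
Definition sdpA_feasible (R : realType) (n : nat) (X : nat -> 'M[R]_n) : Prop :=
  [/\ forall k, (1 <= k <= n./2)%N -> (X k)^T = X k,
      forall k, (1 <= k <= n./2)%N -> nonnegmx (X k),
      \sum_(1 <= k < n./2.+1) X k = allones_mx R n - 1%:M
    & forall i, (1 <= i <= n./2)%N ->
        psdmx (1%:M + \sum_(1 <= k < n./2.+1)
                        cos (2 * pi * i%:R * k%:R / n%:R) *: X k)].

Definition sdpA_obj (R : realType) (n : nat) (D : 'M[R]_n)
    (X : nat -> 'M[R]_n) : R :=
  2^-1 * \tr (D *m X 1%N).

Definition sdpB_feasible (R : realType) (n : nat)
    (Y : 'M[R]_(n * n)) (y : 'cV[R]_(n * n)) : Prop :=
  let I := 1%:M : 'M[R]_n in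
  let J := allones_mx R n in
  let e := const_mx 1 : 'cV[R]_(n * n) in
  [/\ Y^T = Y,
      \tr ((I *t (J - I)) *m Y + ((J - I) *t I) *m Y) = 0,
      \tr Y - 2 * (e^T *m y) 0 0 = - n%:R,
      psdmx (block_mx (1%:M : 'M[R]_1) y^T y Y)
    & nonnegmx Y].

Definition sdpB_obj (R : realType) (n : nat) (D : 'M[R]_n)
    (Y : 'M[R]_(n * n)) : R :=
  2^-1 * \tr ((circuit_mx R n *t D) *m Y).

(* Optimal values are infima in the extended reals, so an infeasible program
   has value +oo and an unbounded one -oo. *)
Definition sdpA_value (R : realType) (n : nat) (D : 'M[R]_n) : \bar R :=
  ereal_inf [set v | exists2 X, sdpA_feasible X & v = (sdpA_obj D X)%:E].

Definition sdpB_value (R : realType) (n : nat) (D : 'M[R]_n) : \bar R :=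
  ereal_inf [set v | exists Y y,
    sdpB_feasible Y y /\ v = (sdpB_obj D Y)%:E].

(* Main.v *)
Require Import Defs.
From mathcomp Require Import all_boot all_order all_algebra.
From mathcomp Require Import all_classical all_reals all_analysis.
From mathcomp Require Import zify ring lra.

(** The two programs have the same set of attained objective values, because
    feasible points can be carried over in both directions without changing
    the objective.  Read the index set of (B) as pairs (position a on the
    circuit, city i), and Y as an n by n array of n by n blocks.

    From (B) to (A), let X^(k) be the sum of the blocks (a, b) of Y over all
    positions at circuit distance k ([dist_classes]).  The objectives agree,
    as C_1 is the indicator of distance 1 ([sdpB_obj_dist_classes]).  The
    matrix sum_k cos(2 pi i k / n) X^(k) equals
    sum_(a, b) cos(2 pi i (a - b) / n) Y^(a, b), and the addition formula for
    the cosine writes it as a sum of two congruences of Y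
    ([fourier_dist_classes]), hence it is positive semidefinite.  The linear
    constraints come from the trace conditions of (B), which express that the
    bordered matrix annihilates the vectors (-1, indicator of a city)
    ([column_sums]); this gives X^(0) = I and sum_k X^(k) = J.

    From (A) to (B), take as block (a, b) the matrix X^(k) of the distance k
    between a and b, divided by the number of pairs at that distance
    ([spread]), and let y be constant equal to 1/n.  Applying [dist_classes]
    gives X back, so again the objectives agree.  Fourier inversion on the
    cyclic group ([spread_fourier]) writes Y as a combination of congruences
    of the matrices sum_k cos(2 pi i k / n) X^(k).  That of frequency 0 is J,
    and contributes y y^T; the others are positive semidefinite by assumption,
    so that Y - y y^T, and hence the bordered matrix, is positive
    semidefinite ([psdmx_spread], [psdmx_border]). *)

Set Implicit Arguments.
Unset Strict Implicit.
Unset Printing Implicit Defensive.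

Import Order.TTheory GRing.Theory Num.Theory.
Local Open Scope ring_scope.

(** * Sums of cosines over the n-th roots of unity *)

Definition angle (R : realType) (n i k : nat) : R :=
  2 * pi * i%:R * k%:R / n%:R.

Lemma angleD (R : realType) n i k l :
  angle R n i (k + l) = angle R n i k + angle R n i l.
Proof. by rewrite /angle natrD mulrDr mulrDl. Qed.

Lemma angleC (R : realType) n i k : angle R n i k = angle R n k i.
Proof. by rewrite /angle -!mulrA; congr (_ * (_ * _)); rewrite mulrCA. Qed.

Lemma angle0 (R : realType) n i : angle R n i 0 = 0.
Proof. by rewrite /angle mulr0 mul0r. Qed.

Lemma angle_full (R : realType) n i : (0 < n)%N ->
  angle R n i n = pi *+ 2 *+ i.
Proof.
move=> n0; rewrite /angle mulfK ?pnatr_eq0 -?lt0n //.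
by rewrite mulr_natr mulr_natl.
Qed.

Lemma cosB_full (R : realType) i x : cos (pi *+ 2 *+ i - x) = cos x :> R.
Proof. by rewrite addrC periodicn ?cosN //; exact: cosD2pi. Qed.

Lemma sinB_full (R : realType) i x : sin (pi *+ 2 *+ i - x) = - sin x :> R.
Proof. by rewrite addrC periodicn ?sinN //; exact: sinD2pi. Qed.

Lemma cos_angleB (R : realType) n i k : (k <= n)%N ->
  cos (angle R n i (n - k)) = cos (angle R n i k).
Proof.
case: n => [|n] kn; first by move: kn; rewrite leqn0 => /eqP->.
have -> : angle R n.+1 i (n.+1 - k) = pi *+ 2 *+ i - angle R n.+1 i k.
  by rewrite -(@angle_full R n.+1) // -{4}(subnK kn) angleD addrK.
exact: cosB_full.
Qed.

Lemma sin_half_angle_neq0 (R : realType) n m : (0 < m < n)%N ->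
  sin (angle R n 1 m / 2) != 0.
Proof.
move=> /andP[m0 mn]; apply: lt0r_neq0; apply: sin_gt0_pi.
have n0 : 0 < n%:R :> R by rewrite ltr0n (leq_trans _ mn).
have -> : angle R n 1 m / 2 = pi * (m%:R / n%:R).
  by rewrite /angle; field; rewrite gt_eqF.
apply/andP; split; first by rewrite mulr_gt0 ?pi_gt0 ?divr_gt0 ?n0 ?ltr0n.
by rewrite gtr_pMr ?pi_gt0 // ltr_pdivrMr // mul1r ltr_nat.
Qed.

(** With x the angle of m/n turn, 2 sin(x/2) cos(ix) is the increment of
    sin(ix - x/2) in i; over a full period the increments telescope to 0, and
    sin(x/2) is nonzero because n does not divide m. *)
Lemma sum_cos_angle (R : realType) n m : (0 < m < n)%N ->
  \sum_(i < n) cos (angle R n i m) = 0.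
Proof.
move=> mn; have n0 : (0 < n)%N by case/andP: mn => _; apply: leq_trans.
apply: (mulfI (sin_half_angle_neq0 R mn)); rewrite mulr0.
apply: (@mulIf _ 2); first by rewrite pnatr_eq0.
set h := angle R n 1 m / 2.
pose f i := sin (angle R n i m - h).
have step i : angle R n i.+1 m = angle R n i m + (h + h).
  by rewrite [LHS]angleC -addn1 angleD angleC (angleC R n m 1) /h -splitr.
rewrite mul0r mulr_sumr mulr_suml -(big_mkord xpredT
  (fun i => sin h * cos (angle R n i m) * 2)).
rewrite (eq_bigr (fun i => f i.+1 - f i)); last first.
  by move=> i _; rewrite /f step addrA addrK sinB sinD; ring.
rewrite telescope_sumr // /f [angle _ _ n _]angleC angle_full // sinB_full.
by rewrite angleC angle0 sub0r sinN subrr.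
Qed.

(** The same telescoping, with -cos(ix - x/2) as the primitive. *)
Lemma sum_sin_angle (R : realType) n m : (0 < m < n)%N ->
  \sum_(i < n) sin (angle R n i m) = 0.
Proof.
move=> mn; have n0 : (0 < n)%N by case/andP: mn => _; apply: leq_trans.
apply: (mulfI (sin_half_angle_neq0 R mn)); rewrite mulr0.
apply: (@mulIf _ 2); first by rewrite pnatr_eq0.
set h := angle R n 1 m / 2.
pose f i := - cos (angle R n i m - h).
have step i : angle R n i.+1 m = angle R n i m + (h + h).
  by rewrite [LHS]angleC -addn1 angleD angleC (angleC R n m 1) /h -splitr.
rewrite mul0r mulr_sumr mulr_suml -(big_mkord xpredT
  (fun i => sin h * sin (angle R n i m) * 2)).
rewrite (eq_bigr (fun i => f i.+1 - f i)); last first.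
  by move=> i _; rewrite /f step addrA addrK cosB cosD; ring.
rewrite telescope_sumr // /f [angle _ _ n _]angleC angle_full // cosB_full.
by rewrite angleC angle0 sub0r cosN subrr.
Qed.

Definition cos_gram (R : realType) n k l : R :=
  \sum_(i < n) cos (angle R n i k) * cos (angle R n i l).

Lemma cos_gramC (R : realType) n k l : cos_gram R n k l = cos_gram R n l k.
Proof. by apply: eq_bigr => i _; rewrite mulrC. Qed.

(** Product-to-sum turns this into cosine sums of frequencies k + l and
    k - l.  The bound n/2 on both indices is what keeps k + l strictly below n,
    so that neither frequency is 0 modulo n. *)
Lemma cos_gram_neq (R : realType) n k l : (k <= n./2)%N -> (l <= n./2)%N ->
  k != l -> cos_gram R n k l = 0.
Proof.
wlog lk : k l / (l < k)%N.
  move=> H kn ln kl; case: (ltngtP l k) => [lk|lk|e]; first exact: H.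
    by rewrite cos_gramC; apply: H; rewrite // eq_sym.
  by rewrite e eqxx in kl.
move=> kn ln _; apply: (@mulIf _ 2); first by rewrite pnatr_eq0.
rewrite mul0r mulr_suml.
rewrite (eq_bigr (fun i : 'I_n => cos (angle R n i (k + l))
                          + cos (angle R n i (k - l)))); last first.
  move=> i _.
  have -> : angle R n i (k - l) = angle R n i k - angle R n i l.
    by rewrite -{2}(subnK (ltnW lk)) angleD addrK.
  by rewrite angleD cosD cosB; ring.
by rewrite big_split /= !sum_cos_angle ?addr0 //; lia.
Qed.

(** * Distance along the circuit *)

Definition cdist n (a b : nat) : nat :=
  let m := (a - b + (b - a))%N in minn m (n - m).

Lemma cdistC n a b : cdist n a b = cdist n b a.
Proof. by rewrite /cdist addnC. Qed.

Lemma cdist_le n (a b : 'I_n) : (cdist n a b <= n./2)%N.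
Proof. by rewrite /cdist; case: a b => [a ha] [b hb] /=; lia. Qed.

Lemma cdist_eq0 n (a b : 'I_n) : (cdist n a b == 0%N) = (a == b).
Proof. by rewrite /cdist -val_eqE; case: a b => [a ha] [b hb] /=; lia. Qed.

(** The distance is a - b up to sign and modulo n, and the cosine of an n-th
    of a turn sees neither.  Splitting it into two rank-one terms is what
    later turns Fourier sums into congruences. *)
Lemma cos_cdist (R : realType) n i (a b : 'I_n) :
  cos (angle R n i (cdist n a b)) =
  cos (angle R n i a) * cos (angle R n i b)
  + sin (angle R n i a) * sin (angle R n i b).
Proof.
wlog ba : a b / (b <= a)%N.
  move=> H; case/orP: (leq_total b a) => h; first exact: H.
  by rewrite cdistC H // mulrC [sin _ * _]mulrC.
rewrite -cosB -(subnK ba) angleD addrK.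
rewrite /cdist subnK // (eqP ba) addn0 /minn; case: ifP => // _.
by rewrite cos_angleB // (leq_trans (leq_subr _ _)) // ltnW.
Qed.

(** For n at least 3 the two residues 1 and -1 are those at distance 1.  At
    n = 1 this fails: there every entry of the circuit matrix is 1. *)
Lemma circuit_mxE (R : realType) n (a b : 'I_n) : (3 <= n)%N ->
  circuit_mx R n a b = (cdist n a b == 1%N)%:R.
Proof.
move=> hn; rewrite mxE; congr (nat_of_bool _)%:R.
case: a b => [a ha] [b hb] /=; rewrite !eqz_mod_dvd.
apply/idP/idP => [|/eqP h].
  (* |a - b -+ 1| <= n, so only the multiples -n, 0 and n can occur. *)
  have npos : 0 < n%:Z by lia.
  have bound (q : int) : - 2 * n%:Z < q * n%:Z -> q * n%:Z < 2 * n%:Z ->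
      q = 0 \/ q = 1 \/ q = -1.
    by rewrite !ltr_pM2r //; lia.
  case/orP=> /dvdzP[q e]; have [||e0|[e0|e0]] := bound q; try lia;
    by subst q; rewrite /cdist; lia.
have [e|[e|[e|e]]] : a = b.+1 \/ b = a.+1 \/
    (a + 1 = b + n)%N \/ (b + 1 = a + n)%N.
- by move: h; rewrite /cdist; lia.
- by apply/orP; left; apply/dvdzP; exists 0; lia.
- by apply/orP; right; apply/dvdzP; exists 0; lia.
- by apply/orP; right; apply/dvdzP; exists 1; lia.
- by apply/orP; left; apply/dvdzP; exists (-1); lia.
Qed.

(** For k <= n/2 this is 1 / #{(a, b) | cdist n a b = k}, as [sum_cweight]
    shows.  Writing it through the squared norm of the cosine vector of
    frequency k, rather than as a count, makes Fourier inversion immediate and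
    avoids treating k = 0 and k = n/2 apart. *)
Definition cweight (R : realType) n k : R := cos_gram R n k k / n%:R ^+ 2.

Lemma cweight_ge0 (R : realType) n k : 0 <= cweight R n k.
Proof.
rewrite divr_ge0 ?exprn_ge0 ?ler0n //; apply: sumr_ge0 => i _.
by rewrite -expr2 sqr_ge0.
Qed.

Lemma cweight0 (R : realType) n : cweight R n 0 = n%:R^-1.
Proof.
rewrite /cweight /cos_gram (eq_bigr (fun=> 1)).
  rewrite sumr_const card_ord; case: n => [|n]; first by rewrite invr0 mul0r.
  by rewrite expr2 invfM mulrA mulfV ?mul1r // pnatr_eq0.
by move=> i _; rewrite angle0 cos0 mulr1.
Qed.

(** By orthogonality of the cosine vectors, the summand is the Gram entry of
    cdist n a b and k for all a and b, whether or not the distance is k.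
    Exchanging the sums, the frequency i contributes
    cos(2 pi i k / n) |sum_a exp(2 pi sqrt(-1) i a / n)|^2, which vanishes
    except at i = 0, where it is n^2. *)
Lemma sum_cweight (R : realType) n k : (0 < n)%N -> (k <= n./2)%N ->
  \sum_(a < n) \sum_(b < n) (cdist n a b == k)%:R * cweight R n k = 1.
Proof.
move=> n0 kn.
have nz : n%:R ^+ 2 != 0 :> R by rewrite expf_neq0 // pnatr_eq0 -lt0n.
under eq_bigr => a _.
  under eq_bigr => b _.
    rewrite (_ : _ * _ = cos_gram R n (cdist n a b) k / n%:R ^+ 2); last first.
      rewrite /cweight; case: eqP => [->|/eqP ne]; first by rewrite mul1r.
      by rewrite mul0r cos_gram_neq ?mul0r // cdist_le.
    over.
  rewrite -mulr_suml.
  over.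
rewrite -mulr_suml; apply: (mulIf nz); rewrite mulfVK // mul1r.
under eq_bigr => a _ do rewrite exchange_big /=.
rewrite exchange_big /=.
case: n n0 kn nz => // n _ kn nz.
rewrite big_ord_recl [X in _ + X]big1 => [|i _].
  rewrite addr0 angleC angle0 cos0.
  under eq_bigr => a _.
    under eq_bigr => b _ do rewrite angleC angle0 cos0 mulr1.
    rewrite sumr_const card_ord.
    over.
  by rewrite sumr_const card_ord -mulrnA -natrX.
have hi : (0 < lift ord0 i < n.+1)%N by exact: ltn_ord.
have -> : \sum_(a < n.+1) \sum_(b < n.+1)
   cos (angle R n.+1 (lift ord0 i) (cdist n.+1 a b))
     * cos (angle R n.+1 (lift ord0 i) k)
  = ((\sum_(a < n.+1) cos (angle R n.+1 a (lift ord0 i))) ^+ 2 +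
    (\sum_(a < n.+1) sin (angle R n.+1 a (lift ord0 i))) ^+ 2)
     * cos (angle R n.+1 (lift ord0 i) k).
  rewrite !expr2 !mulr_suml -big_split /= mulr_suml.
  apply: eq_bigr => a _; rewrite !mulr_sumr -big_split /= mulr_suml.
  apply: eq_bigr => b _; rewrite cos_cdist.
  by rewrite !(angleC R n.+1 (lift ord0 i)).
by rewrite sum_cos_angle // sum_sin_angle // expr0n addr0 mul0r.
Qed.

(** * Positive semidefinite matrices *)

Lemma psdmxD (R : realType) m (A B : 'M[R]_m) :
  psdmx A -> psdmx B -> psdmx (A + B).
Proof.
move=> [As Ap] [Bs Bp]; split=> [|v]; first by rewrite linearD /= As Bs.
by rewrite mulmxDr mulmxDl mxE addr_ge0.
Qed.

Lemma psdmxZ (R : realType) m (c : R) (A : 'M[R]_m) :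
  0 <= c -> psdmx A -> psdmx (c *: A).
Proof.
move=> c0 [As Ap]; split=> [|v]; first by rewrite linearZ /= As.
by rewrite -scalemxAr -scalemxAl mxE mulr_ge0.
Qed.

Lemma psdmx_sum (R : realType) m (I : Type) (r : seq I) (P : pred I)
    (A : I -> 'M[R]_m) :
  (forall i, P i -> psdmx (A i)) -> psdmx (\sum_(i <- r | P i) A i).
Proof.
move=> Ap; apply: big_ind => //; last exact: psdmxD.
by split=> [|v]; rewrite ?trmx0 // mulmx0 mul0mx mxE.
Qed.

Lemma psdmx_congr (R : realType) m p (P : 'M[R]_(m, p)) (A : 'M[R]_p) :
  psdmx A -> psdmx (P *m A *m P^T).
Proof.
move=> [As Ap]; split=> [|v]; first by rewrite !trmx_mul As trmxK mulmxA.
have := Ap (P^T *m v); congr (0 <= (fun_of_matrix _ _ _)).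
by rewrite trmx_mul trmxK !mulmxA.
Qed.

Lemma psdmx1 (R : realType) m : psdmx (1%:M : 'M[R]_m).
Proof.
split=> [|v]; first exact: trmx1.
by rewrite mulmx1 mxE; apply: sumr_ge0 => i _; rewrite mxE -expr2 sqr_ge0.
Qed.

(** With z = Z w, the form at z + t w is affine in t with slope 2 |z|^2; an
    affine function that stays nonnegative is constant. *)
Lemma psdmx_form0 (R : realType) m (Z : 'M[R]_m) (w : 'cV[R]_m) :
  psdmx Z -> (w^T *m Z *m w) 0 0 = 0 -> Z *m w = 0.
Proof.
move=> [Zs Zp] w0; set z := Z *m w.
pose b := (z^T *m z) 0 0; pose c := (z^T *m Z *m z) 0 0.
have zE : w^T *m Z = z^T by rewrite /z trmx_mul Zs.
have quad t : 0 <= c + 2 * t * b.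
  have := Zp (z + t *: w).
  have -> : (z + t *: w)^T = z^T + t *: w^T by rewrite linearD linearZ.
  rewrite !mulmxDl !mulmxDr -!scalemxAl -!scalemxAr zE -(mulmxA z^T Z w) -/z.
  have wz : (z^T *m w) 0 0 = 0 by rewrite -zE.
  rewrite /b /c; move: (z^T *m Z *m z) (z^T *m z) (z^T *m w) wz => C B W W0.
  by rewrite !mxE W0 => h; apply: le_trans h _; lra.
have b0 : b = 0.
  apply/eqP; apply: contraT => bn0.
  (* At this t the affine function takes the value -1. *)
  have := quad (- (c + 1) / (2 * b)).
  rewrite (_ : c + _ = -1) ?ler0N1 //.
  by field.
apply/colP => i; rewrite [RHS]mxE; apply/eqP; rewrite -sqrf_eq0.
move: b0; rewrite /b mxE (eq_bigr (fun k => z k 0 ^+ 2)); last first.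
  by move=> k _; rewrite [z^T _ _]mxE -expr2.
move/eqP; rewrite psumr_eq0 => [/allP h|k _]; last exact: sqr_ge0.
exact: h (mem_index_enum i).
Qed.

(** The Schur complement criterion for a corner equal to 1: the bordered matrix
    is the square of the column (1, y) plus Y - y y^T in the lower corner. *)
Lemma psdmx_border (R : realType) m (y : 'cV[R]_m) (Y : 'M[R]_m) :
  psdmx (Y - y *m y^T) -> psdmx (block_mx (1%:M : 'M[R]_1) y^T y Y).
Proof.
move=> H.
have -> : block_mx (1%:M : 'M[R]_1) y^T y Y =
    col_mx 1%:M y *m 1%:M *m (col_mx 1%:M y)^T +
    col_mx 0 1%:M *m (Y - y *m y^T) *m (col_mx 0 1%:M)^T.
  rewrite !tr_col_mx !trmx1 !trmx0 mulmx1.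
  rewrite [X in X *m row_mx 0 _]mul_col_mx !mul_col_row.
  rewrite !mulmx1 !mul1mx !mul0mx !mulmx0 add_block_mx.
  by rewrite !addr0 addrC subrK.
by apply: psdmxD; apply: psdmx_congr => //; exact: psdmx1.
Qed.

Lemma psdmx_drsub (R : realType) m p (A : 'M[R]_(m + p)) :
  psdmx A -> psdmx (drsubmx A).
Proof.
move=> /(psdmx_congr (row_mx (0 : 'M[R]_(p, m)) 1%:M)).
rewrite -[X in _ *m X *m _]submxK mul_row_block tr_row_mx mul_row_col.
by rewrite !trmx1 !trmx0 !mul0mx !mul1mx !mulmx0 !mulmx1 !add0r.
Qed.

(** * Block matrices indexed by (position, city) *)

Lemma sum_mxtens (V : nmodType) m n (F : 'I_(m * n) -> V) :
  \sum_p F p = \sum_(a < m) \sum_(i < n) F (mxtens_index (a, i)).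
Proof.
rewrite pair_big /= (reindex (@mxtens_index m n)).
  by apply: eq_bigr => -[a i].
by exists (@mxtens_unindex m n) => p _; rewrite ?mxtens_indexK ?mxtens_unindexK.
Qed.

(** The matrix c (x) I.  Conjugating by it on one side combines the n by n
    blocks of a large matrix with the weights c a * c b, on the other side
    spreads a small matrix over the blocks with the same weights. *)
Definition slice_mx (R : comNzRingType) n (c : nat -> R) : 'M[R]_(n * n, n) :=
  \matrix_(p, j) (c (mxtens_unindex p).1 * ((mxtens_unindex p).2 == j)%:R).

Local Notation cos_slice R n i :=
  (slice_mx n (fun a => cos (angle R n i a))).
Local Notation sin_slice R n i :=
  (slice_mx n (fun a => sin (angle R n i a))).

Lemma slice_mxE (R : comNzRingType) n (c : nat -> R) (a i j : 'I_n) :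
  slice_mx n c (mxtens_index (a, i)) j = c a * (i == j)%:R.
Proof. by rewrite mxE mxtens_indexK. Qed.

Lemma sum_delta (R : pzSemiRingType) n (F : 'I_n -> R) (j : 'I_n) :
  \sum_i F i * (i == j)%:R = F j.
Proof.
rewrite (bigD1 j) //= eqxx mulr1 big1 ?addr0 // => i /negPf->.
by rewrite mulr0.
Qed.

Lemma slice_congrE (R : comNzRingType) n (c : nat -> R) (B : 'M[R]_n) a i b j :
  (slice_mx n c *m B *m (slice_mx n c)^T)
    (mxtens_index (a, i)) (mxtens_index (b, j)) = c a * c b * B i j.
Proof.
rewrite mxE (eq_bigr (fun l => c a * B i l * c b * (l == j)%:R)).
  by rewrite sum_delta; ring.
move=> l _; rewrite [_^T _ _]mxE slice_mxE mxE.
rewrite (eq_bigr (fun k => c a * B k l * (k == i)%:R)).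
  by rewrite sum_delta (eq_sym l); ring.
by move=> k _; rewrite slice_mxE (eq_sym k); ring.
Qed.

Lemma slice_foldE (R : comNzRingType) n (c : nat -> R) (Y : 'M[R]_(n * n)) i j :
  ((slice_mx n c)^T *m Y *m slice_mx n c) i j =
  \sum_(a < n) \sum_(b < n)
    c a * c b * Y (mxtens_index (a, i)) (mxtens_index (b, j)).
Proof.
rewrite mxE sum_mxtens [RHS]exchange_big /=; apply: eq_bigr => b _.
rewrite (eq_bigr (fun l => (\sum_(a < n) c a * c b *
   Y (mxtens_index (a, i)) (mxtens_index (b, l))) * (l == j)%:R)).
  by rewrite sum_delta.
move=> l _; rewrite slice_mxE mxE sum_mxtens !mulr_suml; apply: eq_bigr => a _.
rewrite (eq_bigr (fun k => c a *
   Y (mxtens_index (a, k)) (mxtens_index (b, l)) * (k == i)%:R)).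
  by rewrite sum_delta; ring.
by move=> k _; rewrite mxE slice_mxE; ring.
Qed.

(** * The correspondence between the two programs *)

(** From (B) to (A).  When Y is the square of the 0-1 vector of a tour, this is
    the adjacency matrix of the pairs of cities at distance k along the tour. *)
Definition dist_classes (R : realType) n (Y : 'M[R]_(n * n)) k : 'M[R]_n :=
  \matrix_(i, j) \sum_(a < n) \sum_(b < n)
    (cdist n a b == k)%:R * Y (mxtens_index (a, i)) (mxtens_index (b, j)).

(** The identity matrix plays the role of the class of distance 0; adjoining it
    puts I + sum_k in the constraints of (A) into the form sum_(k >= 0). *)
Definition with_diag (R : realType) n (X : nat -> 'M[R]_n) k : 'M[R]_n :=
  if k == 0%N then 1%:M else X k.

Lemma with_diagP (R : realType) n (X : nat -> 'M[R]_n) (P : 'M[R]_n -> Prop) :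
  P 1%:M -> (forall k, (1 <= k <= n./2)%N -> P (X k)) ->
  forall k, (k <= n./2)%N -> P (with_diag X k).
Proof. by move=> P1 PX [|k] kn //; apply: PX. Qed.

Lemma with_diag_id (R : realType) n (X : nat -> 'M[R]_n) k :
  X 0%N = 1%:M -> with_diag X k = X k.
Proof. by case: k. Qed.

(** From (A) to (B): each matrix is shared equally among the blocks of its
    class, so that [dist_classes] undoes [spread]. *)
Definition spread (R : realType) n (X : nat -> 'M[R]_n) : 'M[R]_(n * n) :=
  \matrix_(p, q)
    let k := cdist n (mxtens_unindex p).1 (mxtens_unindex q).1 in
    cweight R n k * with_diag X k (mxtens_unindex p).2 (mxtens_unindex q).2.

Lemma spreadE (R : realType) n (X : nat -> 'M[R]_n) a i b j :
  spread X (mxtens_index (a, i)) (mxtens_index (b, j)) =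
  cweight R n (cdist n a b) * with_diag X (cdist n a b) i j.
Proof. by rewrite mxE !mxtens_indexK. Qed.

Definition fourier_mx (R : realType) n (X : nat -> 'M[R]_n) i : 'M[R]_n :=
  \sum_(k < n./2.+1) cos (angle R n i k) *: X k.

Lemma fourier_with_diag (R : realType) n (X : nat -> 'M[R]_n) i :
  1%:M + \sum_(1 <= k < n./2.+1) cos (2 * pi * i%:R * k%:R / n%:R) *: X k =
  fourier_mx (with_diag X) i.
Proof.
rewrite /fourier_mx -(big_mkord xpredT
  (fun k => cos (angle R n i k) *: with_diag X k)).
rewrite [RHS]big_ltn // angle0 cos0 scale1r; congr (_ + _).
by apply: eq_big_nat => -[|k].
Qed.

Lemma sum_with_diag (R : realType) n (X : nat -> 'M[R]_n) :
  1%:M + \sum_(1 <= k < n./2.+1) X k = \sum_(k < n./2.+1) with_diag X k.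
Proof.
rewrite -(big_mkord xpredT (fun k => with_diag X k)).
rewrite [RHS]big_ltn //; congr (_ + _).
by apply: eq_big_nat => -[|k].
Qed.

Lemma sum_cdist (R : realType) n (a b : 'I_n) (F : nat -> R) :
  \sum_(k < n./2.+1) F k * (cdist n a b == k)%:R = F (cdist n a b).
Proof.
have lt : (cdist n a b < n./2.+1)%N by rewrite ltnS cdist_le.
rewrite -(sum_delta (fun k : 'I_n./2.+1 => F k) (Ordinal lt)).
by apply: eq_bigr => k _; rewrite eq_sym.
Qed.

(** This turns positive semidefiniteness of Y into the matrix inequalities of
    (A): collecting equal distances, the left side is the sum over a and b of
    cos(2 pi i (a - b) / n) times the block (a, b) of Y. *)
Lemma fourier_dist_classes (R : realType) n (Y : 'M[R]_(n * n)) i :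
  fourier_mx (dist_classes Y) i =
  (cos_slice R n i)^T *m Y *m cos_slice R n i
  + (sin_slice R n i)^T *m Y *m sin_slice R n i.
Proof.
apply/matrixP => p q; rewrite [RHS]mxE !slice_foldE -big_split /= summxE.
under [LHS]eq_bigr => k _ do rewrite !mxE mulr_sumr.
rewrite [LHS]exchange_big; apply: eq_bigr => a _ /=; rewrite -big_split /=.
under [LHS]eq_bigr => k _ do rewrite mulr_sumr.
rewrite [LHS]exchange_big; apply: eq_bigr => b _ /=.
rewrite -mulrDl -cos_cdist.
rewrite -[in RHS](sum_cdist a b (fun k => cos (angle R n i k))).
by rewrite mulr_suml; apply: eq_bigr => k _; rewrite mulrA.
Qed.

(** Fourier inversion: the reason why the inequalities of (A), imposed
    frequency by frequency, suffice for Y to be positive semidefinite.  When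
    block (a, b) of the right side is expanded, the coefficients of X^(k) over
    all frequencies add up to the Gram entry of cdist n a b and k, which is 0
    unless these are equal. *)
Lemma spread_fourier (R : realType) n (X : nat -> 'M[R]_n) :
  spread X = n%:R ^- 2 *: \sum_(i < n)
    (cos_slice R n i *m fourier_mx (with_diag X) i
       *m (cos_slice R n i)^T
    + sin_slice R n i *m fourier_mx (with_diag X) i
       *m (sin_slice R n i)^T).
Proof.
apply/matrixP => p q.
case: (mxtens_indexP p) => a r; case: (mxtens_indexP q) => b s.
rewrite spreadE mxE summxE.
under eq_bigr => i _.
  rewrite mxE !slice_congrE -mulrDl -cos_cdist summxE mulr_sumr.
  under eq_bigr => k _ do rewrite mxE mulrA.
  over.
rewrite exchange_big /=.
under eq_bigr => k _ do rewrite -mulr_suml -/(cos_gram R n _ k).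
have lt : (cdist n a b < n./2.+1)%N by rewrite ltnS cdist_le.
rewrite (bigD1 (Ordinal lt)) //= [X in _ + X]big1 => [|k kd].
  by rewrite addr0 /cweight mulrAC mulrC.
have ne : cdist n a b != k by move: kd; rewrite -val_eqE eq_sym.
have kn : (k <= n./2)%N := ltn_ord k.
by rewrite (@cos_gram_neq R n _ _ (cdist_le a b) kn ne) mul0r.
Qed.

Lemma dist_classes_spread (R : realType) n (X : nat -> 'M[R]_n) k :
  (0 < n)%N -> (k <= n./2)%N -> dist_classes (spread X) k = with_diag X k.
Proof.
move=> n0 kn; apply/matrixP => i j; rewrite mxE.
rewrite -[RHS]mul1r -[X in _ = X * _](@sum_cweight R n k n0 kn) mulr_suml.
apply: eq_bigr => a _; rewrite mulr_suml; apply: eq_bigr => b _.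
by rewrite spreadE mulrA; case: eqP => [->|_] //; rewrite !mul0r.
Qed.

Lemma mxtrace_tens_mul (R : realType) n (A B : 'M[R]_n) (Y : 'M[R]_(n * n)) :
  \tr ((A *t B) *m Y) = \sum_(a < n) \sum_(i < n) \sum_(b < n) \sum_(j < n)
    A a b * B i j * Y (mxtens_index (b, j)) (mxtens_index (a, i)).
Proof.
rewrite /mxtrace sum_mxtens; apply: eq_bigr => a _; apply: eq_bigr => i _.
rewrite mxE sum_mxtens; apply: eq_bigr => b _; apply: eq_bigr => j _.
by rewrite tensmxE.
Qed.

Lemma sdpB_obj_dist_classes (R : realType) n (D : 'M[R]_n) (Y : 'M[R]_(n * n)) :
  (3 <= n)%N -> sdpB_obj D Y = sdpA_obj D (dist_classes Y).
Proof.
move=> hn; rewrite /sdpB_obj /sdpA_obj; congr (_ * _).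
rewrite mxtrace_tens_mul exchange_big; apply: eq_bigr => i _ /=.
rewrite mxE.
under [LHS]eq_bigr => a _ do rewrite exchange_big.
rewrite [LHS]exchange_big; apply: eq_bigr => j _ /=.
rewrite mxE mulr_sumr exchange_big; apply: eq_bigr => b _ /=.
rewrite mulr_sumr; apply: eq_bigr => a _.
by rewrite circuit_mxE // cdistC; ring.
Qed.

(** Pairs of assignments that a permutation excludes: one position with two
    cities, or two positions with one city. *)
Definition conflict n (a i b j : 'I_n) := (a == b) (+) (i == j).

Lemma conflict_trace (R : realType) n (Y : 'M[R]_(n * n)) :
  \tr (((1%:M : 'M[R]_n) *t (allones_mx R n - 1%:M)) *m Y
     + ((allones_mx R n - 1%:M) *t (1%:M : 'M[R]_n)) *m Y) =
  \sum_(a < n) \sum_(i < n) \sum_(b < n) \sum_(j < n)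
    (conflict a i b j)%:R * Y (mxtens_index (b, j)) (mxtens_index (a, i)).
Proof.
rewrite mxtraceD !mxtrace_tens_mul -big_split; apply: eq_bigr => a _ /=.
rewrite -big_split; apply: eq_bigr => i _ /=.
rewrite -big_split; apply: eq_bigr => b _ /=.
rewrite -big_split; apply: eq_bigr => j _ /=.
rewrite -mulrDl !mxE /conflict; congr (_ * _).
by case: eqP; case: eqP => _ _ /=; ring.
Qed.

(** On nonnegative matrices the single trace equation of (B) is a sum of
    nonnegative terms, hence a sparsity pattern. *)
Lemma conflict_trace_eq0 (R : realType) n (Y : 'M[R]_(n * n)) :
  nonnegmx Y ->
  \tr (((1%:M : 'M[R]_n) *t (allones_mx R n - 1%:M)) *m Y
     + ((allones_mx R n - 1%:M) *t (1%:M : 'M[R]_n)) *m Y) = 0 <->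
  forall a i b j, conflict a i b j ->
    Y (mxtens_index (b, j)) (mxtens_index (a, i)) = 0.
Proof.
move=> Y0; rewrite conflict_trace.
have t0 a i b j : 0 <=
    (@conflict n a i b j)%:R * Y (mxtens_index (b, j)) (mxtens_index (a, i)).
  by rewrite mulr_ge0 ?ler0n ?Y0.
split=> [H a i b j ab|H]; last first.
  do 4![apply: big1 => ? _]; case c : conflict; last by rewrite mul0r.
  by rewrite H ?mulr0.
have {}H := psumr_eq0P (fun a _ => sumr_ge0 _ (fun i _ => sumr_ge0 _
  (fun b _ => sumr_ge0 _ (fun j _ => t0 a i b j)))) H (i := a) isT.
have {}H := psumr_eq0P (fun i _ => sumr_ge0 _
  (fun b _ => sumr_ge0 _ (fun j _ => t0 a i b j))) H (i := i) isT.
have {}H := psumr_eq0P (fun b _ => sumr_ge0 _ (fun j _ => t0 a i b j)) H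
  (i := b) isT.
have := psumr_eq0P (fun j _ => t0 a i b j) H (i := j) isT.
by rewrite ab mul1r.
Qed.

(** (A) only imposes the frequencies up to n/2; the frequencies i and n - i
    give the same matrix. *)
Lemma psdmx_fourier (R : realType) n (X : nat -> 'M[R]_n) i :
  (forall i, (1 <= i <= n./2)%N -> psdmx (fourier_mx X i)) ->
  (0 < i < n)%N -> psdmx (fourier_mx X i).
Proof.
move=> H iP; case: (leqP i n./2) => [il|il]; first by apply: H; lia.
have -> : fourier_mx X i = fourier_mx X (n - i); last by apply: H; lia.
apply: eq_bigr => k _; rewrite (angleC _ _ (n - i)) cos_angleB; last by lia.
by rewrite angleC.
Qed.

(** In the Fourier expansion of the spread matrix, frequency 0 contributes
    exactly y y^T; the remaining frequencies are congruences of positive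
    semidefinite matrices. *)
Lemma psdmx_spread (R : realType) n (X : nat -> 'M[R]_n) (y : 'cV[R]_(n * n)) :
  y = const_mx n%:R^-1 -> fourier_mx (with_diag X) 0 = const_mx 1 ->
  (forall i, (1 <= i <= n./2)%N -> psdmx (fourier_mx (with_diag X) i)) ->
  psdmx (spread X - y *m y^T).
Proof.
case: n X y => [|n] X y yE F0 Fp.
  split=> [|v]; first by apply/matrixP => -[].
  by rewrite mxE big1 // => -[].
have -> : spread X - y *m y^T = n.+1%:R ^- 2 *: \sum_(i < n)
    (cos_slice R n.+1 i.+1 *m fourier_mx (with_diag X) i.+1
       *m (cos_slice R n.+1 i.+1)^T
    + sin_slice R n.+1 i.+1 *m fourier_mx (with_diag X) i.+1
       *m (sin_slice R n.+1 i.+1)^T).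
  rewrite spread_fourier big_ord_recl scalerDr addrAC.
  rewrite [X in X + _ = _](_ : _ = 0) ?add0r //.
  have -> : y *m y^T = n.+1%:R ^- 2 *: const_mx 1.
    apply/matrixP => p q; rewrite yE !mxE big_ord1 !mxE mulr1.
    by rewrite -invfM -expr2.
  rewrite -scalerBr; apply/eqP; rewrite scaler_eq0 subr_eq0; apply/orP; right.
  apply/eqP/matrixP => p q.
  case: (mxtens_indexP p) => a r; case: (mxtens_indexP q) => b s.
  rewrite mxE !slice_congrE F0 !mxE !(angleC _ _ 0) !angle0 cos0 sin0.
  by rewrite !mul0r addr0 !mulr1.
apply: psdmxZ; first by rewrite invr_ge0 exprn_ge0 ?ler0n.
apply: psdmx_sum => i _; have := @psdmx_fourier R n.+1 (with_diag X) i.+1 Fp.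
by move=> /(_ (ltn_ord (lift ord0 i))) FP; apply: psdmxD; apply: psdmx_congr.
Qed.

(** * Feasible points correspond *)

Lemma spread_feasible (R : realType) n (X : nat -> 'M[R]_n) :
  (0 < n)%N -> sdpA_feasible X ->
  sdpB_feasible (spread X) (const_mx n%:R^-1).
Proof.
move=> n0 [Xs X0 XJ Xp].
have nz : n%:R != 0 :> R by rewrite pnatr_eq0 -lt0n.
have Ws := with_diagP (P := fun M => M^T = M) (trmx1 _ _) Xs.
have W0 := @with_diagP R n X (@nonnegmx R n) _ X0.
have {}W0 k : (k <= n./2)%N -> nonnegmx (with_diag X k).
  by apply: W0 => i j; rewrite mxE ler0n.
have S0 : nonnegmx (spread X).
  move=> p q; case: (mxtens_indexP p) => a i; case: (mxtens_indexP q) => b j.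
  by rewrite spreadE mulr_ge0 ?cweight_ge0 // W0 // cdist_le.
have WJ : \sum_(k < n./2.+1) with_diag X k = allones_mx R n.
  by rewrite -sum_with_diag XJ addrC subrK.
(* Nonnegative matrices with sum J - I all have zero diagonal. *)
have Xdiag k i : (1 <= k <= n./2)%N -> X k i i = 0.
  case: k => // k /= kn; have : (\sum_(l < n./2) X l.+1) i i = 0.
    have := congr1 (fun M : 'M[R]_n => M i i) WJ.
    by rewrite big_ord_recl !mxE eqxx -[RHS]addr0 => /addrI.
  rewrite summxE => H.
  exact: (psumr_eq0P (fun (l : 'I_n./2) _ => X0 l.+1 (ltn_ord l) i i) H
    (i := Ordinal kn) isT).
split=> //.
- apply/matrixP => p q; rewrite mxE.
  case: (mxtens_indexP p) => a i; case: (mxtens_indexP q) => b j.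
  by rewrite !spreadE cdistC -[in LHS]Ws ?cdist_le // mxE.
- apply/conflict_trace_eq0 => // a i b j; rewrite spreadE /conflict.
  rewrite /with_diag cdist_eq0 eq_sym; case: eqP => [->|/eqP ab] /= ij.
    by rewrite mxE eq_sym (negPf ij) mulr0.
  rewrite (eqP ij) Xdiag ?mulr0 // cdist_le lt0n cdist_eq0 ab //.
- rewrite /mxtrace sum_mxtens.
  have E0 (a i : 'I_n) :
      spread X (mxtens_index (a, i)) (mxtens_index (a, i)) = n%:R^-1.
    have /eqP c0 : cdist n a a == 0%N by rewrite cdist_eq0.
    by rewrite spreadE c0 cweight0 mxE eqxx mulr1.
  under eq_bigr => a _ do under eq_bigr => i _ do rewrite E0.
  rewrite mxE sum_mxtens.
  under [X in _ - 2 * X]eq_bigr => a _ do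
    under eq_bigr => i _ do rewrite !mxE mul1r.
  rewrite !sumr_const !card_ord -(mulr_natr n%:R^-1) mulVf //; ring.
- apply: psdmx_border; apply: psdmx_spread => //.
    rewrite -[RHS]WJ; apply: eq_bigr => k _.
    by rewrite angleC angle0 cos0 scale1r.
  by move=> i iP; rewrite -fourier_with_diag; apply: Xp.
Qed.

(** Let w_j be the vector (-1, indicator of city j), for which the form of the
    bordered matrix Z relaxes the square of (number of visits to city j) - 1.
    Given the sparsity pattern, tr Y - 2 e^T y + n is the sum of these forms
    over j.  They are nonnegative, hence all zero, and so Z w_j = 0; the two
    conclusions are the rows of this identity. *)
Lemma column_sums (R : realType) n (Y : 'M[R]_(n * n)) (y : 'cV[R]_(n * n)) :
  sdpB_feasible Y y ->
  [/\ forall j, \sum_(a < n) y (mxtens_index (a, j)) 0 = 1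
    & forall p j, \sum_(b < n) Y p (mxtens_index (b, j)) = y p 0].
Proof.
move=> [Ys conf trY Zp Y0].
have {}conf := (conflict_trace_eq0 Y0).1 conf.
pose g (j : 'I_n) : 'cV[R]_(n * n) := \col_p ((mxtens_unindex p).2 == j)%:R.
pose w j : 'cV[R]_(1 + n * n) := col_mx (- 1%:M) (g j).
pose Z := block_mx (1%:M : 'M[R]_1) y^T y Y.
have gE j a i : g j (mxtens_index (a, i)) 0 = (i == j)%:R.
  by rewrite mxE mxtens_indexK.
have Yg p j : (Y *m g j) p 0 = \sum_(b < n) Y p (mxtens_index (b, j)).
  rewrite mxE sum_mxtens; apply: eq_bigr => b _.
  rewrite -[RHS](sum_delta (fun i => Y p (mxtens_index (b, i))) j).
  by apply: eq_bigr => i _; rewrite gE.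
have gu (u : 'cV[R]_(n * n)) j :
    ((g j)^T *m u) 0 0 = \sum_(a < n) u (mxtens_index (a, j)) 0.
  rewrite mxE sum_mxtens; apply: eq_bigr => b _.
  rewrite -[RHS](sum_delta (fun i => u (mxtens_index (b, i)) 0) j).
  by apply: eq_bigr => i _; rewrite mxE gE mulrC.
have gy j : (g j)^T *m y = (y^T *m g j)^T by rewrite trmx_mul trmxK.
have yg j : (y^T *m g j) 0 0 = \sum_(a < n) y (mxtens_index (a, j)) 0.
  by rewrite -gu gy [RHS]mxE.
have Zw j : Z *m w j = col_mx (y^T *m g j - 1%:M) (Y *m g j - y).
  by rewrite mul_block_col !mulmxN !mulmx1 ![- _ + _]addrC.
have q_ge0 j : 0 <= ((w j)^T *m Z *m w j) 0 0 by apply: (Zp.2 (w j)).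
have qE j : ((w j)^T *m Z *m w j) 0 0 =
    1 - 2 * (\sum_(a < n) y (mxtens_index (a, j)) 0)
    + \sum_(a < n) Y (mxtens_index (a, j)) (mxtens_index (a, j)).
  rewrite -mulmxA Zw tr_col_mx mul_row_col linearN /= trmx1 mulNmx mul1mx.
  rewrite mulmxBr gy -yg.
  have -> : \sum_(a < n) Y (mxtens_index (a, j)) (mxtens_index (a, j)) =
      ((g j)^T *m (Y *m g j)) 0 0.
    rewrite gu; apply: eq_bigr => a _; rewrite Yg (bigD1 a) //= big1 ?addr0 //.
    move=> b ba; rewrite conf // /conflict eqxx addbT.
    by move: ba; rewrite eq_sym.
  move: ((g j)^T *m (Y *m g j)) (y^T *m g j) => A B.
  by rewrite !mxE eqxx mulr1n; ring.
have q0 : \sum_j ((w j)^T *m Z *m w j) 0 0 = 0.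
  under eq_bigr => j _ do rewrite qE.
  rewrite big_split /= sumrB -mulr_sumr sumr_const card_ord.
  have -> : \sum_(j < n) \sum_(a < n)
      Y (mxtens_index (a, j)) (mxtens_index (a, j)) = \tr Y.
    by rewrite /mxtrace sum_mxtens exchange_big.
  move: trY; rewrite mxE sum_mxtens exchange_big /=.
  under eq_bigr => j _ do under eq_bigr => a _ do rewrite !mxE mul1r.
  lra.
have Zw0 j : Z *m w j = 0.
  apply: psdmx_form0 => //.
  exact: (psumr_eq0P (fun j _ => q_ge0 j) q0 (i := j) isT).
split=> [j|p j].
- have := Zw0 j; rewrite Zw -[RHS](col_mx0) => /eq_col_mx[/matrixP/(_ 0 0) + _].
  by rewrite !mxE -yg mxE => /eqP; rewrite subr_eq0 => /eqP.
- have := Zw0 j; rewrite Zw -[RHS](col_mx0) => /eq_col_mx[_ /matrixP/(_ p 0)].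
  by rewrite -Yg !mxE => /eqP; rewrite subr_eq0 => /eqP.
Qed.

Lemma dist_classes_feasible (R : realType) n (Y : 'M[R]_(n * n))
    (y : 'cV[R]_(n * n)) :
  sdpB_feasible Y y -> sdpA_feasible (dist_classes Y).
Proof.
move=> feas; have [y1 Yy] := column_sums feas.
case: feas => Ys conf _ Zp Y0.
have {}conf := (conflict_trace_eq0 Y0).1 conf.
have X0 : dist_classes Y 0 = 1%:M.
  apply/matrixP => i j; rewrite !mxE.
  under eq_bigr => a _.
    rewrite (bigD1 a) //= big1 => [|b ba]; last first.
      by rewrite cdist_eq0 eq_sym (negPf ba) mul0r.
    rewrite addr0 (eqP (_ : cdist n a a == 0%N)) ?cdist_eq0 // mul1r.
    over.
  case: eqP => [->|/eqP ij]; last first.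
    apply: big1 => a _; apply: conf; rewrite /conflict eqxx /=.
    by rewrite eq_sym.
  (* In the row of (a, j), only the diagonal entry meets city j, so that the
     diagonal of Y is y. *)
  rewrite -(y1 j); apply: eq_bigr => a _.
  rewrite -(Yy _ j) (bigD1 a) //= big1 ?addr0 //.
  move=> b ba; rewrite conf // /conflict eqxx addbT.
  by move: ba; rewrite eq_sym.
split.
- move=> k _; apply/matrixP => i j; rewrite !mxE exchange_big /=.
  apply: eq_bigr => a _; apply: eq_bigr => b _.
  by rewrite cdistC -[in LHS]Ys mxE.
- move=> k _ i j; rewrite mxE; apply: sumr_ge0 => a _; apply: sumr_ge0 => b _.
  by rewrite mulr_ge0 ?ler0n ?Y0.
- apply: (addrI 1%:M); rewrite sum_with_diag addrC subrK.
  apply/matrixP => i j; rewrite summxE mxE -(y1 i).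
  under eq_bigr => k _ do rewrite with_diag_id // mxE.
  rewrite exchange_big; apply: eq_bigr => a _ /=.
  rewrite exchange_big -(Yy _ j); apply: eq_bigr => b _ /=.
  rewrite -[RHS](sum_cdist a b
    (fun=> Y (mxtens_index (a, i)) (mxtens_index (b, j)))).
  by apply: eq_bigr => k _; rewrite mulrC.
- move=> i _; rewrite fourier_with_diag.
  have -> : fourier_mx (with_diag (dist_classes Y)) i =
      fourier_mx (dist_classes Y) i.
    by apply: eq_bigr => k _; rewrite with_diag_id.
  rewrite fourier_dist_classes.
  have Yp : psdmx Y by move: (psdmx_drsub Zp); rewrite block_mxKdr.
  by apply: psdmxD; rewrite -[X in _ *m _ *m X]trmxK; apply: psdmx_congr.
Qed.

Theorem theorem3 (R : realType) (n : nat) (D : 'M[R]_n)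
    (hn : (3 <= n)%N)
    (Dsym : D^T = D)
    (Dpos : forall i j : 'I_n, i != j -> 0 < D i j) :
  sdpA_value D = sdpB_value D.
Proof.
have n0 : (0 < n)%N by apply: leq_trans hn.
have d1 : (1 <= n./2)%N by lia.
rewrite /sdpA_value /sdpB_value; congr ereal_inf.
apply/seteqP; split=> [v [X feas ->]|v [Y [y [feas ->]]]] /=.
  exists (spread X), (const_mx n%:R^-1); split; first exact: spread_feasible.
  by rewrite sdpB_obj_dist_classes // /sdpA_obj dist_classes_spread.
exists (dist_classes Y); first exact: dist_classes_feasible feas.
by rewrite sdpB_obj_dist_classes.
Qed.
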